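(* Let $(W,S)$ be a tubular elliptic Weyl system, let $(\tilde W,\tilde S)$ be its hyperbolic cover, let $T$ and $\tilde T$ be the respective sets of reflections, and let $c\in W$ and $\tilde c\in\tilde W$ be the corresponding Coxeter transformations. Then $\ell_{\tilde T}(\tilde c)=\ell_T(c)$, and $\ell_T(c)$ equals the rank $|S|$ of the elliptic Weyl system.
   Context: Root systems. Let $V$ be a finite-dimensional real vector space with a symmetric bilinear form $(-\mid-)$ with radical $R$. For a vector $\alpha$ with $(\alpha\mid\alpha)\ne0$ put $s_\alpha(v)=v-\frac{2(\alpha\mid v)}{(\alpha\mid\alpha)}\alpha$. A generalized root system is a non-empty set $\Phi\subseteq V$ of non-isotropic vectors with $\mathrm{span}_{\mathbb R}(\Phi)=V$, $s_\alpha(\Phi)\subseteq\Phi$ for all $\alpha\in\Phi$, and $\frac{2(\alpha\mid\beta)}{(\beta\mid\beta)}\in\mathbb Z$ for all $\alpha,\beta\in\Phi$; its root lattice $L(\Phi)=\mathrm{span}_{\mathbb Z}(\Phi)$ is a lattice in $V$ (generated by an $\mathbb R$-basis of $V$). It is reduced if $r\alpha\in\Phi$ ($\alpha\in\Phi$, $r\in\mathbb R$) implies $r=\pm1$, and irreducible if it is not a union of two mutually orthogonal generalized root systems. It is elliptic if it is irreducible and reduced and $(-\mid-)$ has signature $(n,0,2)$ (numbers of positive, negative, zero eigenvalues), $n+2=\dim V$. Standing assumption: $(\alpha\mid\alpha)=2$ for all $\alpha\in\Phi$. Choices. Fix a $1$-dimensional subspace $U\le R$ with $U\cap L(\Phi)\ne\{0\}$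 and $a$ with $L(\Phi)\cap U=\mathbb Za$. The image $\Phi/U$ of $\Phi$ in $V/U$ is an irreducible affine root system; let $\beta_0,\dots,\beta_n$ be a root basis (simple system) of it such that $\beta_1,\dots,\beta_n$ is a root basis of a finite root system ($\beta_0$ being the affine node in the standard numbering), and let $m_1,\dots,m_n$ be the unique positive integers such that $\beta_0+\sum_{i=1}^n m_i\beta_i$ spans $L(\Phi/U)\cap R/U$; put $m_0=1$. Choose preimages $\alpha_i\in\Phi$ of $\beta_i$ and put $b=\sum_{i=0}^n m_i\alpha_i\in R$, $V_{\mathrm{fin}}=\sum_{i=1}^n\mathbb R\alpha_i$. Tubular case. Let $m_{\max}=\max_i m_i$. The elliptic root basis is $B=\{\alpha_0,\dots,\alpha_n\}\cup\{\alpha_i+a\mid m_i=m_{\max}\}$. $\Phi$ and $B$ are tubular if exactly one index $t$ satisfies $m_t=m_{\max}$; then put $\alpha_{t^\star}=\alpha_t+a$, $M=\{0,\dots,n,t^\star\}$, $s_i=s_{\alpha_i}$ for $i\in M$, $S=\{s_i\mid i\in M\}$ and $W=\langle s_\alpha\mid\alpha\in\Phi\rangle\le \mathrm{GL}(V)$. $(W,S)$ is called a tubular elliptic Weyl system. Hyperbolic cover. Let $\hat V\supseteq V$ be the space with non-degenerate form of signature $(n+2,2,0)$ extending that of $V$, $\hat V=V_{\mathrm{fin}}\perp\langle a,a'\rangle\perp\langle b,b'\rangle$ with $(a,a'),(b,b')$ hyperbolic pairs (isotropic vectors with product $1$), and let $\tilde V=V\oplus\mathbb Rb'\subset\hat V$.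 For $i\in M$ let $\tilde s_i$ be the reflection of $\tilde V$ with respect to $\alpha_i$; $\tilde S=\{\tilde s_i\mid i\in M\}$, $\tilde W=\langle\tilde S\rangle$. Reflections, lengths, Coxeter transformations. $T=\bigcup_{w\in W}wSw^{-1}$, $\tilde T=\bigcup_{w\in\tilde W}w\tilde Sw^{-1}$; $\ell_T(w)$ is the minimal number of factors in an expression of $w$ as a product of elements of $T$, and similarly for $\ell_{\tilde T}$. A Coxeter transformation is $c=\left(\prod_{i\in M\setminus\{t,t^\star\}}s_i\right)s_ts_{t^\star}$ with the first $|B|-2$ factors in arbitrary order; the corresponding $\tilde c\in\tilde W$ is the same product of the $\tilde s_i$. *)

(* Defs.v *)
From HB Require Import structures.
From mathcomp Require Import all_boot all_order all_algebra.
From mathcomp Require Import boolp classical_sets cardinality reals.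

Set Implicit Arguments.
Unset Strict Implicit.
Unset Printing Implicit Defensive.

Import Order.TTheory GRing.Theory Num.Theory.

Local Open Scope classical_set_scope.
Local Open Scope ring_scope.

Section Reflections.
Variables (R : realType) (V : vectType R) (f : {symmetric V}).

Definition refl_fun (alpha v : V) : V :=
  v - (2 * f alpha v / f alpha alpha) *: alpha.

Fact refl_fun_is_linear alpha : linear (refl_fun alpha).
Proof.
move=> k u v; rewrite /refl_fun linearDr linearZr /= mulrDr mulrDl scalerDl.
rewrite opprD addrACA scalerBr scalerA; congr (_ - _ *: _ + _).
by rewrite mulrCA !mulrA.
Qed.

HB.instance Definition _ alpha :=
  GRing.isLinear.Build R V V *:%R (refl_fun alpha) (refl_fun_is_linear alpha).

Definition refl (alpha : V) : 'End(V) := linfun (refl_fun alpha).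

Lemma reflE alpha v :
  refl alpha v = v - (2 * f alpha v / f alpha alpha) *: alpha.
Proof. by rewrite lfunE. Qed.

End Reflections.

Section Restriction.
Variables (R : realType) (V : vectType R) (f : {symmetric V}) (A : {vspace V}).

Definition restr_form (u v : subvs_of A) : R := f (vsval u) (vsval v).

Fact restr_form_bilinear : bilinear_for *%R (idfun \; *%R) restr_form.
Proof.
split=> [u' k u v | u k u' v'] /=; rewrite /restr_form [vsval (_ + _)]linearP.
  by rewrite linearDl linearZl_LR.
by rewrite linearDr linearZr_LR.
Qed.

HB.instance Definition _ := bilinear_isBilinear.Build R (subvs_of A)
  (subvs_of A) R *%R (idfun \; *%R) restr_form restr_form_bilinear.

Fact restr_form_sym u v :
  restr_form u v = (-1) ^+ false * idfun (restr_form v u).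
Proof. exact: hermC. Qed.

HB.instance Definition _ := isHermitianSesquilinear.Build R (subvs_of A)
  false idfun restr_form restr_form_sym.

End Restriction.

Section Signature.
Variables (R : realType) (V : vectType R) (f : {symmetric V}).

Definition gram : 'M[R]_(\dim {:V}) :=
  \matrix_(i, j) f (vbasis {:V})`_i (vbasis {:V})`_j.

(* The eigenvalues of the Gram matrix, with multiplicity, consist of [p]
   positive, [q] negative and [r] zero ones; by Sylvester's law of inertia
   these numbers do not depend on the basis used in [gram]. *)
Definition has_signature (p q r : nat) : Prop :=
  exists s : seq R,
    [/\ char_poly gram = \prod_(x <- s) ('X - x%:P),
        count (fun x => 0 < x) s = p,
        count (fun x => x < 0) s = q &
        count (fun x => x == 0) s = r].

Definition hyperbolic_pair (u v : V) : Prop :=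
  [/\ f u u = 0, f v v = 0 & f u v = 1].

End Signature.

Section RootSystems.
Variables (R : realType) (V : vectType R).
Implicit Types (Phi Psi : set V) (W : {vspace V}).

Definition rspan Phi : set V :=
  [set v | exists2 s : seq V, {in s, forall x, Phi x} & v \in <<s>>%VS].

Definition zspan Phi : set V :=
  [set v | exists2 s : seq V, {in s, forall x, Phi x} &
           exists k : V -> int, v = \sum_(x <- s) x *~ k x].

Variable f : {symmetric V}.

(* [Phi] is a generalized root system in the subspace [W], equipped with the
   restriction of [f]; the root lattice is required to be a lattice in [W]. *)
Record root_system W Phi : Prop := RootSystem {
  root_nonempty : Phi !=set0;
  root_nonisotropic : forall alpha, Phi alpha -> f alpha alpha != 0;
  root_span : rspan Phi = [set` W];
  root_refl : forall alpha beta, Phi alpha -> Phi beta ->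
    Phi (refl f alpha beta);
  root_int : forall alpha beta, Phi alpha -> Phi beta ->
    2 * f alpha beta / f beta beta \is a Num.int;
  root_lattice : exists2 X : seq V, basis_of W X & zspan Phi = zspan [set` X]
}.

Definition reduced Phi : Prop :=
  forall (alpha : V) (r : R), Phi alpha -> Phi (r *: alpha) ->
    r = 1 \/ r = -1.

Definition irreducible Phi : Prop :=
  ~ exists Phi1 Phi2 : set V,
    [/\ exists W1, root_system W1 Phi1,
        exists W2, root_system W2 Phi2,
        forall x y, Phi1 x -> Phi2 y -> f x y = 0 &
        Phi = Phi1 `|` Phi2].

Record elliptic (n : nat) Phi : Prop := Elliptic {
  elliptic_root_system : root_system {:V} Phi;
  elliptic_irreducible : irreducible Phi;
  elliptic_reduced : reduced Phi;
  elliptic_signature : has_signature f n 0 2;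
  elliptic_dim : \dim {:V} = n.+2
}.

Definition finite_root_system W Phi : Prop :=
  root_system W Phi /\ finite_set Phi.

Definition root_basis Phi k (beta : 'I_k -> V) : Prop :=
  [/\ forall i, Phi (beta i),
      free [seq beta i | i <- enum 'I_k] &
      forall x, Phi x -> exists d : 'I_k -> nat,
        x = \sum_i beta i *+ d i \/ x = - \sum_i beta i *+ d i].

End RootSystems.

(* [pi : V -> Q] is a model of the projection onto [V / U], for [U] contained
   in the radical of [f], and [g] is the form on it induced by [f]. *)
Record quotient_space (R : realType) (V Q : vectType R) (f : {symmetric V})
    (U : {vspace V}) (pi : 'Hom(V, Q)) (g : {symmetric Q}) : Prop :=
  QuotientSpace {
    quotient_ker : lker pi = U;
    quotient_surj : limg pi = fullv;
    quotient_form : forall x y, g (pi x) (pi y) = f x y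
  }.

Record hyperbolic_cover (R : realType) (V Vh : vectType R) (f : {symmetric V})
    (n : nat) (Vfin : {vspace V}) (a b : V) (fh : {symmetric Vh})
    (iota : 'Hom(V, Vh)) (a' b' : Vh) : Prop := HyperbolicCover {
  cover_inj : lker iota = 0%VS;
  cover_isometry : isometry fh f iota;
  cover_nondegenerate : nondegenerate fh;
  cover_signature : has_signature fh n.+2 2 0;
  cover_sum :
    (iota @: Vfin + <<[:: iota a; a']>> + <<[:: iota b; b']>>)%VS = fullv;
  cover_direct :
    directv (iota @: Vfin + <<[:: iota a; a']>> + <<[:: iota b; b']>>);
  cover_orth_a : (iota @: Vfin <= orthov fh <<[:: iota a; a']>>)%VS;
  cover_orth_b : (iota @: Vfin <= orthov fh <<[:: iota b; b']>>)%VS;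
  cover_orth_ab : (<<[:: iota a; a']>> <= orthov fh <<[:: iota b; b']>>)%VS;
  cover_pair_a : hyperbolic_pair fh (iota a) a';
  cover_pair_b : hyperbolic_pair fh (iota b) b'
}.

(* The subspace [V + R b'] of the hyperbolic cover. *)
Definition cover_space (R : realType) (V Vh : vectType R) (iota : 'Hom(V, Vh))
  (b' : Vh) : {vspace Vh} := (limg iota + <[b']>)%VS.

(* The index set M is [option 'I_n.+1], with [None] in the role of t^*. *)
Definition tubular_root (R : realType) (V : vectType R) n
    (alpha : 'I_n.+1 -> V) (a : V) (t : 'I_n.+1) (i : option 'I_n.+1) : V :=
  if i is Some j then alpha j else alpha t + a.

Section Groups.
Variables (R : realType) (V : vectType R).
Implicit Types (X W S T : set 'End(V)) (w : 'End(V)).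

(* The subgroup of GL(V) generated by the set [X] of invertible maps. *)
Inductive gen_group X : set 'End(V) :=
| gen_one : gen_group X \1%VF
| gen_mem x : X x -> gen_group X x
| gen_mul x y : gen_group X x -> gen_group X y -> gen_group X (x \o y)%VF
| gen_inv x : gen_group X x -> gen_group X (x^-1)%VF.

Definition reflections W S : set 'End(V) :=
  [set (w \o s \o w^-1)%VF | w in W & s in S].

Definition lfun_prod (s : seq 'End(V)) : 'End(V) :=
  \big[@comp_lfun R V V V / \1%VF]_(g <- s) g.

Definition factorization T w (s : seq 'End(V)) : Prop :=
  {in s, forall g, T g} /\ w = lfun_prod s.

(* [w] is a product of elements of [T], and [k] is its length. *)
Definition has_length T w (k : nat) : Prop :=
  (exists2 s, factorization T w s & size s = k) /\
  (forall s, factorization T w s -> (k <= size s)%N).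

End Groups.

(* Main.v *)
Require Import Defs.
From mathcomp Require Import all_boot all_order all_algebra.
From mathcomp Require Import boolp classical_sets cardinality reals.
From mathcomp Require Import ring.

Set Implicit Arguments.
Unset Strict Implicit.
Unset Printing Implicit Defensive.

Import Order.TTheory GRing.Theory Num.Theory.

Local Open Scope classical_set_scope.
Local Open Scope card_scope.
Local Open Scope ring_scope.

(** Write e_1, ..., e_n for the simple roots other than alpha_t and alpha_t + a,
    in the order in which they enter the Coxeter transformation.  Since a is in
    the radical, the last two reflections compose to v |-> v - (alpha_t | v) a,
    and

      c v = v - sum_i psi_i(v) e_i - (alpha_t | v) a,

    where Y psi(v) = ((e_i | v))_i and Y is the unipotent triangular matrix with
    entries (e_i | e_j) above the diagonal ([seifert], [coxeterE]).  A product
    of k reflections is the identity modulo a space of dimension at most k, so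
    k is at least the codimension of the fixed space ([factor_bound]), and
    k has the parity of n + 2 because reflections have determinant -1
    ([factor_parity]).

    The vectors fixed by c are those orthogonal to all simple roots.  Both in V
    and in its extension by b' they lie in the plane spanned by a and b, the
    nondegenerate ambient form of the cover making the span of
    alpha_1, ..., alpha_n nondegenerate ([radical_of_cover],
    [tubular_coxeter_fixed], [cover_coxeter_fixed]).  In the cover, of
    dimension n + 3, this gives k >= n + 1, and the parity then gives
    k >= n + 2.

    In V, of dimension n + 2, it only gives k >= n, and the value k = n is
    excluded by arithmetic ([no_short_factorization]).  Suppose
    c = s_{x_1} ... s_{x_n} with x_j = sum_i P_ij e_i + p_j alpha_t + q_j a
    and integers P_ij, p_j, q_j.  Comparing coordinates with the formula above
    shows that P is invertible over the reals, that p = 0, and that the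
    unipotent matrix X of the x_j is P^T Y P.  Hence det P = 1 or -1, so
    z = q P^-1 is an integral row, and z psi(v) = (alpha_t | v).  As
    m_t alpha_t + sum_i m(e_i) e_i lies in the radical, m_t z = - m Y; the first
    column of Y is the first unit vector, so m_t divides the mark of e_1.  But
    that mark is positive and, m_t being the unique maximum, smaller than
    m_t. *)

(** * Reflections and the groups they generate *)

Lemma symm_formC (R : realType) (V : vectType R) (f : {symmetric V}) u v :
  f u v = f v u.
Proof. by rewrite hermC expr0 mul1r. Qed.

Lemma lker0_id (R : realType) (V : vectType R) :
  lker (\1 : 'End(V))%VF == 0%VS.
Proof. by apply/lker0P=> u v; rewrite !id_lfunE. Qed.

Section ReflectionFacts.
Variables (R : realType) (V : vectType R) (f : {symmetric V}).
Implicit Types (x u v : V) (s : seq V).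

Lemma refl_norm2E x v : f x x = 2 -> refl f x v = v - f x v *: x.
Proof.
by move=> nx; rewrite reflE nx mulrC mulrA mulVf ?mul1r // pnatr_eq0.
Qed.

Lemma refl_invol x v : f x x = 2 -> refl f x (refl f x v) = v.
Proof.
move=> nx; rewrite !refl_norm2E // linearBr linearZr_LR /= nx mulr_natr mulr2n.
by rewrite opprD addNKr scaleNr opprK subrK.
Qed.

Lemma refl_lker0 x : f x x = 2 -> lker (refl f x) == 0%VS.
Proof.
by move=> nx; apply/lker0P; apply: (can_inj (fun v => refl_invol v nx)).
Qed.

Lemma refl_isometry x : f x x = 2 -> isometry f f (refl f x).
Proof.
move=> nx u v; rewrite !refl_norm2E // linearBl !linearBr /= !linearZl_LR /=.
rewrite !linearZr_LR /= nx [f u x]symm_formC; ring.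
Qed.

Lemma conj_refl (w : 'End(V)) x :
  lker w == 0%VS -> isometry f f w ->
  (w \o refl f x \o w^-1)%VF = refl f (w x).
Proof.
move=> w0 fw; apply/lfunP=> v; rewrite !lfunE /= !lfunE /= !reflE.
rewrite linearB linearZ /= lker0_lfunVK // -[f x (_ v)]fw -[f x x]fw.
by rewrite lker0_lfunVK.
Qed.

Variable L : V -> Prop.
Hypothesis LS : forall x v, L x -> f x x = 2 -> L v -> L (refl f x v).

(** Invariance of [L] is stated as an equivalence because only then does it
    pass from an element of the group to its inverse. *)
Lemma gen_group_refl (X : set 'End(V)) w :
  (forall g, X g -> exists x, [/\ L x, f x x = 2 & g = refl f x]) ->
  gen_group X w ->
  [/\ lker w == 0%VS, isometry f f w & forall v, L (w v) <-> L v].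
Proof.
move=> XL; elim=> {w} [|g /XL[x [Lx nx ->]]|g h _ [g0 fg Lg] _ [h0 fh Lh]|].
- split; first exact: lker0_id.
    by move=> u v; rewrite !id_lfunE.
  by move=> v; rewrite id_lfunE.
- split; [exact: refl_lker0 | exact: refl_isometry |].
  move=> v; split; last exact: LS.
  by move/(LS Lx nx); rewrite refl_invol.
- split.
  + apply/lker0P=> u v; rewrite !comp_lfunE => /(lker0P g0); exact/lker0P.
  + by move=> u v; rewrite !comp_lfunE fg fh.
  + by move=> v; rewrite !comp_lfunE Lg Lh.
- move=> g _ [g0 fg Lg]; split.
  + by apply/lker0P; apply: (can_inj (lker0_lfunVK g0)).
  + by move=> u v; rewrite -fg !lker0_lfunVK.
  + by move=> v; rewrite -Lg lker0_lfunVK.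
Qed.

(** A conjugate w s_x w^-1 is the reflection in w x, which again has norm 2
    and satisfies [L]: all that the proof has to know about the conjugates
    occurring in a factorization.  With the root lattice for [L], it is enough
    that lattice vectors of norm 2 take the place of roots. *)
Lemma reflections_refl (X S : set 'End(V)) g :
  (forall g, X g -> exists x, [/\ L x, f x x = 2 & g = refl f x]) ->
  (forall g, S g -> exists x, [/\ L x, f x x = 2 & g = refl f x]) ->
  reflections (gen_group X) S g ->
  exists x, [/\ L x, f x x = 2 & g = refl f x].
Proof.
move=> XL SL [w Ww [s Ss <-]].
have [w0 fw Lw] := gen_group_refl XL Ww; have [x [Lx nx ->]] := SL _ Ss.
by exists (w x); split; [apply/Lw | rewrite fw | exact: conj_refl].
Qed.

Lemma sub_reflections (W S : set 'End(V)) : W \1%VF -> S `<=` reflections W S.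
Proof.
move=> W1 s Ss; exists \1%VF => //; exists s => //.
apply/lfunP=> v; rewrite !comp_lfunE id_lfunE; congr (s _).
by have := lker0_lfunVK (lker0_id V) v; rewrite id_lfunE.
Qed.

End ReflectionFacts.

(** * Determinants of products of reflections *)

Section Determinant.
Import VectorInternalTheory.
Variables (R : realType) (V : vectType R) (f : {symmetric V}).

Definition lfun_det (g : 'End(V)) : R := \det (f2mx g).

Lemma f2mx_mulE (g : 'End(V)) (u : 'rV_(dim V)) :
  u *m f2mx g = v2r (g (r2v u)).
Proof. by rewrite unlock /= !r2vK. Qed.

Lemma lfun_det1 : lfun_det \1%VF = 1.
Proof.
rewrite /lfun_det; suff -> : f2mx (\1 : 'End(V))%VF = 1%:M by rewrite det1.
by apply/row_matrixP=> i; rewrite !rowE mulmx1 f2mx_mulE id_lfunE r2vK.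
Qed.

Lemma lfun_det_comp (g h : 'End(V)) :
  lfun_det (g \o h)%VF = lfun_det g * lfun_det h.
Proof.
rewrite /lfun_det mulrC -det_mulmx; congr (\det _).
apply/row_matrixP=> i.
by rewrite !rowE mulmxA !f2mx_mulE v2rK comp_lfunE.
Qed.

(** Both sides are the determinant of the block matrix with identity diagonal
    blocks and off-diagonal blocks u and v, factored in two ways. *)
Lemma det_rank1 k (u : 'cV[R]_k) (v : 'rV[R]_k) :
  \det (1%:M - u *m v) = 1 - (v *m u) 0 0.
Proof.
pose B := block_mx 1%:M u v 1%:M.
have B1 : B = block_mx 1%:M 0 v 1%:M *m block_mx 1%:M u 0 (1%:M - v *m u).
  rewrite mulmx_block !mulmx1 !mulmx0 !mul1mx !mul0mx !addr0.
  by rewrite [_ *m u + _]addrC subrK.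
have B2 : B = block_mx 1%:M u 0 1%:M *m block_mx (1%:M - u *m v) 0 v 1%:M.
  by rewrite mulmx_block !mulmx1 !mulmx0 !mul1mx !mul0mx !add0r subrK.
have := congr1 determinant B2; rewrite B1 !det_mulmx !det_lblock !det_ublock.
by rewrite !det1 !mul1r !mulr1 => <-; rewrite det_mx11 !mxE.
Qed.

Lemma lfun_det_refl x : f x x = 2 -> lfun_det (refl f x) = -1.
Proof.
move=> nx; pose C := \col_i f x (r2v (delta_mx 0 i)).
have fC v : f x v = (v2r v *m C) 0 0.
  rewrite -{1}[v]v2rK {1}[v2r v]matrix_sum_delta big_ord1 !linear_sum mxE /=.
  by apply: eq_bigr => i _; rewrite !linearZ /= !mxE.
suff E : f2mx (refl f x) = 1%:M - C *m v2r x.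
  by rewrite /lfun_det E det_rank1 -fC nx; ring.
apply/row_matrixP=> i; rewrite !rowE.
rewrite f2mx_mulE refl_norm2E // linearB linearZ /= r2vK mulmxBr mulmx1 mulmxA.
congr (_ - _).
by rewrite -rowE [row i C]mx11_scalar mul_scalar_mx !mxE.
Qed.

Lemma lfun_det_prod_refl s :
  {in s, forall g, exists2 x, f x x = 2 & g = refl f x} ->
  lfun_det (lfun_prod s) = (-1) ^+ size s.
Proof.
elim: s => [|g s IH] sP; first by rewrite /lfun_prod big_nil lfun_det1.
rewrite /lfun_prod big_cons lfun_det_comp -/(lfun_prod s) IH.
  have [x nx ->] := sP g (mem_head _ _); by rewrite lfun_det_refl ?exprS.
by move=> h hs; apply: sP; rewrite inE hs orbT.
Qed.

End Determinant.

(** * Products of reflections in coordinates *)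

Section Seifert.
Variables (R : realType) (V : vectType R) (f : {symmetric V}).

Definition refl_prod k (x : 'I_k -> V) : 'End(V) :=
  lfun_prod [seq refl f (x i) | i <- enum 'I_k].

Lemma refl_prod_recl k (x : 'I_k.+1 -> V) :
  refl_prod x = (refl f (x ord0) \o refl_prod (fun i => x (lift ord0 i)))%VF.
Proof. by rewrite /refl_prod enum_ordSl /= /lfun_prod big_cons -map_comp. Qed.

(** The coefficient phi_i is (x_i | s_{i+1} ... s_k v); expanding the product
    to the right of s_i expresses it through the later coefficients. *)
Lemma refl_prod_expand k (x : 'I_k -> V) v : (forall i, f (x i) (x i) = 2) ->
  exists phi : 'I_k -> R,
    refl_prod x v = v - \sum_i phi i *: x i /\
    forall i, f (x i) v =
      phi i + \sum_(j < k | (i < j)%N) f (x i) (x j) * phi j.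
Proof.
elim: k x => [|k IH] x nx.
  exists (fun=> 0); rewrite big_ord0 subr0; split=> [|[]//].
  by rewrite /refl_prod enum_ord0 /lfun_prod big_nil id_lfunE.
have [//|phi [E phiP]] := IH (fun i => x (lift ord0 i)).
set w := refl_prod _ v in E.
pose psi i := if unlift ord0 i is Some j then phi j else f (x ord0) w.
have psi0 : psi ord0 = f (x ord0) w by rewrite /psi unlift_none.
have psiS i : psi (lift ord0 i) = phi i by rewrite /psi liftK.
exists psi; split.
  rewrite refl_prod_recl comp_lfunE -/w refl_norm2E // big_ord_recl psi0.
  by under eq_bigr do rewrite psiS; rewrite {1}E opprD addrA addrAC.
move=> i; case: (unliftP ord0 i) => [j|] ->.
  rewrite psiS phiP big_mkcond [in RHS]big_mkcond big_ord_recl /= add0r.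
  by congr (_ + _); apply: eq_bigr => l _;
    rewrite psiS /bump !leq0n !add1n ltnS.
rewrite psi0 E linearBr linear_sum /= [X in _ = _ + X]big_mkcond /=.
rewrite [X in _ = _ + X]big_ord_recl /= add0r.
apply/eqP; rewrite -addrA addrC -subr_eq subrr eq_sym addrC subr_eq0; apply/eqP.
by apply: eq_bigr => l _; rewrite psiS linearZr_LR /= mulrC.
Qed.

(** The unipotent triangular half of the Gram matrix of vectors of norm 2: the
    Gram matrix is the sum of [seifert x] and its transpose. *)
Definition seifert k (x : 'I_k -> V) : 'M[R]_k :=
  \matrix_(i, j) if (i < j)%N then f (x i) (x j) else (i == j)%:R.

Lemma det_seifert k (x : 'I_k -> V) : \det (seifert x) = 1.
Proof.
rewrite -det_tr det_trig.
  by rewrite big1 // => i _; rewrite !mxE ltnn eqxx.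
apply/is_trig_mxP=> i j lij; rewrite !mxE ltnNge ltnW //=.
by case: eqP lij => // ->; rewrite ltnn.
Qed.

Lemma seifert_unit k (x : 'I_k -> V) : seifert x \in unitmx.
Proof. by rewrite unitmxE det_seifert unitr1. Qed.

Lemma refl_prodE k (x : 'I_k -> V) v : (forall i, f (x i) (x i) = 2) ->
  exists phi : 'cV[R]_k,
    refl_prod x v = v - \sum_i phi i 0 *: x i /\
    seifert x *m phi = \col_i f (x i) v.
Proof.
move=> /(refl_prod_expand v)[phi [E phiP]]; exists (\col_i phi i); split.
  by rewrite E; under [in RHS]eq_bigr do rewrite mxE.
apply/colP=> i; rewrite !mxE phiP (bigD1 i) //= !mxE ltnn eqxx mul1r.
congr (_ + _); rewrite [LHS]big_mkcond [RHS]big_mkcond.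
apply: eq_bigr => j _ /=.
rewrite !mxE eq_sym; case: ltnP => lij.
  by case: eqP lij => // ->; rewrite ltnn.
by case: eqP => //= _; rewrite mul0r.
Qed.

(** The image of s_{x_1} ... s_{x_k} - 1 lies in the span of the x_i. *)
Lemma refl_prod_fixed_dim k (x : 'I_k -> V) : (forall i, f (x i) (x i) = 2) ->
  (\dim {:V} <= \dim (fixedSpace (refl_prod x)) + k)%N.
Proof.
move=> nx; rewrite -(limg_ker_dim (refl_prod x - \1)%VF fullv) capfv leq_add2l.
apply: (@leq_trans (\dim <<[seq x i | i <- enum 'I_k]>>%VS)); last first.
  by rewrite (leq_trans (dim_span _)) // size_map size_enum_ord.
apply/dimvS/subvP=> _ /memv_imgP[v _ ->].
rewrite add_lfunE opp_lfunE id_lfunE; have [phi [-> _]] := refl_prodE v nx.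
rewrite addrAC subrr add0r memvN memv_suml // => i _.
by rewrite memvZ // memv_span // map_f // mem_enum.
Qed.

End Seifert.

(** * Coxeter transformations *)

Lemma norm_shift (R : realType) (V : vectType R) (f : {symmetric V}) x a :
  f x x = 2 -> (forall u, f a u = 0) -> f (x + a) (x + a) = 2.
Proof.
move=> nx a0; rewrite linearDr /= [f _ a]symm_formC a0 addr0 symm_formC.
by rewrite linearDr /= [f _ a]symm_formC a0 nx addr0.
Qed.

(** Modulo the radical vector a the two reflections coincide, so that their
    product is a transvection. *)
Lemma refl_shift (R : realType) (V : vectType R) (f : {symmetric V}) x a v :
  f x x = 2 -> (forall u, f a u = 0) ->
  refl f x (refl f (x + a) v) = v - f x v *: a.
Proof.
move=> nx a0; have xa u : f (x + a) u = f x u by rewrite linearDl /= a0 addr0.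
have fxa : f x a = 0 by rewrite symm_formC.
rewrite (refl_norm2E _ (x := x + a)); last exact: norm_shift.
rewrite refl_norm2E // linearBr linearZr_LR /= linearDr /= nx fxa addr0 xa.
rewrite mulr_natr mulr2n opprD addNKr scaleNr opprK scalerDr opprD.
by rewrite addrA addrAC subrK.
Qed.

Lemma eq_mulmx_cV (K : fieldType) k l (A B : 'M[K]_(k, l)) :
  (forall u : 'cV_l, A *m u = B *m u) -> A = B.
Proof.
move=> AB; apply/matrixP=> i j.
by have := AB (delta_mx j 0); rewrite -!colE => /colP/(_ i); rewrite !mxE.
Qed.

Section Coxeter.
Variables (R : realType) (V : vectType R) (f : {symmetric V}) (n : nat).
Variables (e : 'I_n -> V) (y a : V).
Hypothesis norm_e : forall i, f (e i) (e i) = 2.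
Hypothesis norm_y : f y y = 2.
Hypothesis rad_a : forall v, f a v = 0.

(** The last two reflections are kept apart from the list [e]: they are the ones
    in the roots congruent modulo a. *)
Definition coxeter : 'End(V) :=
  (refl_prod f e \o (refl f y \o refl f (y + a)))%VF.

Lemma coxeterE v : exists psi : 'cV[R]_n,
  coxeter v = v - f y v *: a - \sum_i psi i 0 *: e i /\
  seifert f e *m psi = \col_i f (e i) v.
Proof.
rewrite !comp_lfunE refl_shift //; set u := v - f y v *: a.
have fu i : f (e i) u = f (e i) v.
  by rewrite linearBr linearZr_LR /= [f _ a]symm_formC rad_a mulr0 subr0.
have [psi [Ee Ye]] := refl_prodE u norm_e.
by exists psi; split=> //; rewrite Ye; apply/colP=> i; rewrite !mxE.
Qed.

Hypothesis free_ea : forall (d : 'I_n -> R) s,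
  \sum_i d i *: e i + s *: a = 0 -> (forall i, d i = 0) /\ s = 0.

Lemma coxeter_fixed v :
  coxeter v = v -> (forall i, f (e i) v = 0) /\ f y v = 0.
Proof.
have [psi [-> Ye]] := coxeterE v.
rewrite -addrA -opprD => /(congr1 (fun u => v - u)).
rewrite subKr subrr addrC => /free_ea[psi0 fyv]; split=> // i.
have psiE : psi = 0 by apply/colP=> j; rewrite psi0 mxE.
by have /colP/(_ i) := Ye; rewrite psiE mulmx0 !mxE.
Qed.

End Coxeter.

(** * The Coxeter transformation is not a product of n lattice reflections *)

Section NoShortFactorization.
Variables (R : realType) (V : vectType R) (f : {symmetric V}) (n : nat).
Variables (e x : 'I_n -> V) (y a : V) (m : 'I_n -> nat) (my : nat) (i0 : 'I_n).
Variables (P : 'M[int]_n) (p q : 'rV[int]_n).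
Hypothesis norm_e : forall i, f (e i) (e i) = 2.
Hypothesis norm_x : forall i, f (x i) (x i) = 2.
Hypothesis norm_y : f y y = 2.
Hypothesis rad_a : forall v, f a v = 0.
Hypothesis free_split : forall (d : 'I_n -> R) r s,
  \sum_i d i *: e i + r *: y + s *: a = 0 ->
  [/\ forall i, d i = 0, r = 0 & s = 0].
Hypothesis dual_e : forall w : 'cV[R]_n, exists v, w = \col_i f (e i) v.
Hypothesis rad_sum :
  forall v, my%:R * f y v + \sum_i (m i)%:R * f (e i) v = 0.
Hypothesis i0_first : i0 = 0%N :> nat.
Hypothesis m_bounds : (0 < m i0 < my)%N.
Hypothesis lattice_x : forall j,
  x j = \sum_i e i *~ P i j + y *~ p 0 j + a *~ q 0 j.

(** With X and Y the triangular matrices of [x] and [e], and psi the coordinates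
    of v - c v along [e], a factorization forces X = P^T Y P, so that P is
    unimodular; then y is represented by the integral row z = q P^-1, in the
    sense that (y | v) = z psi(v), and the radical relation [rad_sum] reads
    my z = - m Y.  Its first entry contradicts [m_bounds]. *)
Lemma no_short_factorization :
  refl_prod f x <> coxeter f e y a.
Proof.
move=> E.
pose toR k l (A : 'M[int]_(k, l)) : 'M[R]_(k, l) := map_mx intr A.
pose X := seifert f x; pose Y := seifert f e.
have coords (psi : 'cV[R]_n) : exists v (phi : 'cV[R]_n),
    [/\ Y *m psi = \col_i f (e i) v, X *m phi = \col_i f (x i) v,
        toR _ _ P *m phi = psi, toR _ _ p *m phi = 0 &
        toR _ _ q *m phi = (f y v)%:M].
  (* Duality lets psi be prescribed: choose v with pairings Y psi. *)
  have [v vP] := dual_e (Y *m psi); exists v.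
  have [phi [Ex Xphi]] := refl_prodE v norm_x; exists phi.
  have [psi' [Ec]] := coxeterE norm_e norm_y rad_a v.
  rewrite -vP => /(can_inj (mulKmx (seifert_unit f e))) psiE.
  rewrite {psi'}psiE in Ec.
  have := congr1 (fun g : 'End(V) => g v) E; rewrite /= Ec Ex => {}E.
  have {E} : \sum_i ((toR _ _ P *m phi) i 0 - psi i 0) *: e i
           + ((toR _ _ p *m phi) 0 0) *: y
           + ((toR _ _ q *m phi) 0 0 - f y v) *: a = 0.
    have sumx : \sum_j phi j 0 *: x j = \sum_i (toR _ _ P *m phi) i 0 *: e i
        + (toR _ _ p *m phi) 0 0 *: y + (toR _ _ q *m phi) 0 0 *: a.
      under eq_bigr do rewrite lattice_x !scalerDr scaler_sumr.
      rewrite !big_split exchange_big /=; congr (_ + _ + _).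
      - apply: eq_bigr => i _; rewrite mxE scaler_suml; apply: eq_bigr => j _.
        by rewrite !mxE -scaler_int scalerA mulrC.
      - rewrite mxE scaler_suml; apply: eq_bigr => j _.
        by rewrite !mxE -scaler_int scalerA mulrC.
      - rewrite mxE scaler_suml; apply: eq_bigr => j _.
        by rewrite !mxE -scaler_int scalerA mulrC.
    move: E; rewrite -[v - _ - _]addrA => /addrI/(congr1 -%R).
    rewrite opprD !opprK sumx => E.
    under eq_bigr do rewrite scalerBl.
    rewrite sumrB scalerBl [_ - _ + _]addrAC addrACA -opprD E.
    by rewrite [X in _ - X]addrC subrr.
  case/free_split=> dP rP sP; split=> //.
  - by apply/colP=> i; apply/eqP; rewrite -subr_eq0 dP.
  - by apply/matrixP=> i j; rewrite !ord1 rP mxE.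
  - by rewrite [LHS]mx11_scalar; move/eqP: sP; rewrite subr_eq0 => /eqP->.
have unitP : toR _ _ P \in unitmx.
  have /fin_all_exists[phi phiP] : forall j : 'I_n,
      exists phi : 'cV[R]_n, toR _ _ P *m phi = col j 1%:M.
    move=> j; have [v [phi [_ _ Pphi _ _]]] := coords (col j 1%:M).
    by exists phi.
  apply: (proj1 (mulmx1_unit (B := \matrix_(i, j) phi j i 0) _)).
  apply/matrixP=> i j; have /colP/(_ i) := phiP j; rewrite !mxE => <-.
  by apply: eq_bigr => l _; rewrite !mxE.
(* P being invertible, the other coordinate vector phi may be prescribed too. *)
have {}coords (phi : 'cV[R]_n) : exists v,
    [/\ Y *m (toR _ _ P *m phi) = \col_i f (e i) v, X *m phi = \col_i f (x i) v,
        toR _ _ p *m phi = 0 & toR _ _ q *m phi = (f y v)%:M].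
  have [v [phi' [? ? /(can_inj (mulKmx unitP)) phiE ? ?]]] :=
    coords (toR _ _ P *m phi).
  by exists v; subst phi'.
have p0 : toR _ _ p = 0.
  by apply: eq_mulmx_cV => phi; rewrite mul0mx; have [v []] := coords phi.
(* As p = 0, each x_j is congruent to sum_i P_ij e_i modulo the radical. *)
have XYP : X = (toR _ _ P)^T *m Y *m toR _ _ P.
  apply: eq_mulmx_cV => phi; have [v [Ev -> _ _]] := coords phi.
  rewrite -!mulmxA Ev; apply/colP=> j; rewrite !mxE lattice_x.
  have pj : (p 0 j)%:~R = 0 :> R by have /rowP/(_ j) := p0; rewrite !mxE.
  rewrite -[y *~ _]scaler_int pj scale0r addr0 -[a *~ _]scaler_int.
  rewrite symm_formC linearDr linearZr_LR /= [f v a]symm_formC rad_a mulr0.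
  rewrite addr0 linear_sum /=; apply: eq_bigr => i _.
  by rewrite !mxE -scaler_int linearZr_LR /= symm_formC.
have detP : \det P * \det P = 1.
  apply: (intr_inj (R := R)); have := congr1 determinant XYP.
  by rewrite !det_mulmx det_tr !det_seifert mulr1 det_map_mx intrM => <-.
have PU : P \in unitmx.
  by rewrite unitmxE; apply/unitrP; exists (\det P).
pose z := q *m invmx P.
have zP : my%:R *: toR _ _ z = - (toR _ _ (\row_i (m i)%:Z) *m Y).
  apply: (can_inj (mulmxK unitP)); rewrite -scalemxAl -map_mxM mulmxKV //.
  apply: eq_mulmx_cV => phi; have [v [Ev _ _ qE]] := coords phi.
  rewrite -scalemxAl qE !mulNmx -!mulmxA Ev; apply/matrixP=> i j.
  rewrite !ord1 !mxE /= mulr1n; apply/eqP.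
  rewrite -addr_eq0 -[X in _ == X](rad_sum v).
  by apply/eqP; congr (_ + _); apply: eq_bigr => l _; rewrite !mxE.
(* Column i0 of Y is a unit vector, Y being upper unitriangular. *)
have : my%:Z * z 0 i0 = - (m i0)%:Z.
  apply: (intr_inj (R := R)); have /matrixP/(_ 0 i0) := zP.
  rewrite !mxE rmorphM /= => ->; rewrite rmorphN /=; congr (- _).
  rewrite (bigD1 i0) //= !mxE ltnn eqxx mulr1 big1 ?addr0 // => i ii0.
  by rewrite !mxE i0_first ltn0 (negPf ii0) mulr0.
case/andP: m_bounds => m_gt0 m_lt zE.
have : (my%:Z %| (m i0)%:Z)%Z.
  by apply/dvdzP; exists (- z 0 i0); rewrite mulNr mulrC zE opprK.
by rewrite dvdzE => /(dvdn_leq m_gt0); rewrite leqNgt m_lt.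
Qed.

End NoShortFactorization.

(** * Lower bound and parity for the number of reflections *)

Section Factorizations.
Variables (R : realType) (V : vectType R) (f : {symmetric V}).

Lemma lfun_prod_cat (s1 s2 : seq 'End(V)) :
  lfun_prod (s1 ++ s2) = (lfun_prod s1 \o lfun_prod s2)%VF.
Proof.
rewrite /lfun_prod; elim: s1 => [|g s1 IH] /=.
  by rewrite big_nil comp_lfun1l.
by rewrite !big_cons IH comp_lfunA.
Qed.

Lemma refl_factors (L : V -> Prop) (s : seq 'End(V)) :
  {in s, forall g, exists x, [/\ L x, f x x = 2 & g = refl f x]} ->
  exists x : 'I_(size s) -> V, [/\ forall i, L (x i),
    forall i, f (x i) (x i) = 2 & lfun_prod s = refl_prod f x].
Proof.
elim: s => [|g s IH] sP.
  exists (fun=> 0); split=> [[]//|[]//|].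
  by rewrite /refl_prod enum_ord0.
have [|x [Lx nx sE]] := IH.
  by move=> h hs; apply: sP; rewrite inE hs orbT.
have [x0 [Lx0 nx0 gE]] := sP g (mem_head _ _).
exists (fun i => if unlift ord0 i is Some j then x j else x0); split.
- by move=> i; case: unliftP.
- by move=> i; case: unliftP.
rewrite refl_prod_recl unlift_none -gE /lfun_prod big_cons -/(lfun_prod s) sE.
by congr (_ \o _)%VF; congr (refl_prod f _); apply/funext=> i; rewrite liftK.
Qed.

Lemma factor_bound (s : seq 'End(V)) u w :
  {in s, forall g, exists2 x, f x x = 2 & g = refl f x} ->
  (fixedSpace (lfun_prod s) <= <<[:: u; w]>>)%VS ->
  (\dim {:V} <= size s + 2)%N.
Proof.
move=> sP /dimvS fixS.
have [|x [_ nx sE]] := @refl_factors (fun=> True) s.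
  by move=> g /sP[x nx ->]; exists x.
apply: leq_trans (refl_prod_fixed_dim nx) _; rewrite addnC leq_add2l -sE.
by apply: leq_trans fixS _; apply: dim_span.
Qed.

(** Compare determinants. *)
Lemma factor_parity (s s' : seq 'End(V)) :
  {in s, forall g, exists2 x, f x x = 2 & g = refl f x} ->
  {in s', forall g, exists2 x, f x x = 2 & g = refl f x} ->
  lfun_prod s = lfun_prod s' -> odd (size s) = odd (size s').
Proof.
move=> /lfun_det_prod_refl ds /lfun_det_prod_refl ds' E.
move: ds; rewrite E ds' -signr_odd -[RHS]signr_odd => /eqP.
by rewrite (inj_eq signr_inj) => /eqP.
Qed.

End Factorizations.

(** * The root lattice *)

Section Lattice.
Variables (R : realType) (V : vectType R).
Implicit Types (Phi : set V).

Lemma mem_zspan Phi x : Phi x -> zspan Phi x.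
Proof.
move=> Px; exists [:: x]; first by move=> z; rewrite inE => /eqP->.
by exists (fun=> 1); rewrite big_seq1 mulr1z.
Qed.

(** An integral combination is indexed by a list that may repeat vectors while
    its coefficients depend on the vector only.  Passing to a duplicate-free
    list absorbs the repetitions into the coefficients, which makes two
    combinations comparable. *)
Lemma zspan_widen (s r : seq V) (k : V -> int) : uniq r -> {subset s <= r} ->
  \sum_(x <- s) x *~ k x = \sum_(x <- r) x *~ (k x *+ count_mem x s).
Proof.
move=> ur; elim: s => [|z s IH] sr.
  by rewrite big_nil big1 // => x _; rewrite mulr0n mulr0z.
rewrite big_cons IH; last by move=> x xs; rewrite sr // inE xs orbT.
under [in RHS]eq_bigr do rewrite /= mulrnDr mulrzDr.
rewrite big_split /=; congr (_ + _).
rewrite (bigD1_seq z) ?sr ?mem_head //= eqxx mulr1n big1 ?addr0 // => x xz.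
by rewrite eq_sym (negPf xz) mulr0n mulr0z.
Qed.

Lemma zspanB Phi x y : zspan Phi x -> zspan Phi y -> zspan Phi (x - y).
Proof.
move=> [s sP [k ->]] [r rP [l ->]]; pose u := undup (s ++ r).
exists u; first by move=> z; rewrite mem_undup mem_cat => /orP[/sP|/rP].
exists (fun z => k z *+ count_mem z s - l z *+ count_mem z r).
under [in RHS]eq_bigr do rewrite mulrzBr.
rewrite sumrB; congr (_ - _); apply: zspan_widen; rewrite ?undup_uniq //.
  by move=> z zs; rewrite mem_undup mem_cat zs.
by move=> z zr; rewrite mem_undup mem_cat zr orbT.
Qed.

Lemma zspan0 Phi : zspan Phi 0.
Proof. by exists [::] => //; exists (fun=> 0); rewrite big_nil. Qed.

Lemma zspanN Phi x : zspan Phi x -> zspan Phi (- x).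
Proof. by move=> Px; rewrite -sub0r; apply: zspanB => //; apply: zspan0. Qed.

Lemma zspanD Phi x y : zspan Phi x -> zspan Phi y -> zspan Phi (x + y).
Proof. by move=> Px Py; rewrite -[y]opprK; apply/zspanB/zspanN. Qed.

Lemma zspan_comb Phi k (x : 'I_k -> V) (d : 'I_k -> nat) :
  (forall i, Phi (x i)) -> zspan Phi (\sum_i x i *+ d i).
Proof.
move=> Px; apply: (big_ind (zspan Phi)); [exact: zspan0|exact: zspanD|].
move=> i _; elim: (d i) => [|l IH]; first by rewrite mulr0n; apply: zspan0.
by rewrite mulrS; apply: zspanD IH; apply: mem_zspan.
Qed.

Lemma zspan1P (a v : V) : zspan [set a] v -> exists l : int, v = a *~ l.
Proof.
move=> [s sP [k ->]]; exists (\sum_(x <- s) k x); rewrite mulrz_sumr.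
by apply: eq_big_seq => x /sP ->.
Qed.

Variables (k : nat) (alpha : 'I_k -> V) (a : V).

Definition int_comb v := exists (c : 'I_k -> int) (l : int),
  v = \sum_i alpha i *~ c i + a *~ l.

Lemma int_combB u v : int_comb u -> int_comb v -> int_comb (u - v).
Proof.
move=> [c [l ->]] [c' [l' ->]]; exists (fun i => c i - c' i), (l - l').
rewrite opprD addrACA mulrzBr -sumrB; congr (_ + _).
by apply: eq_bigr => i _; rewrite mulrzBr.
Qed.

Lemma int_combZ v (z : int) : int_comb v -> int_comb (v *~ z).
Proof.
move=> [c [l ->]]; exists (fun i => c i * z), (l * z).
rewrite mulrzDl mulrzA; congr (_ + _); rewrite mulrz_suml.
by apply: eq_bigr => i _; rewrite mulrzA.
Qed.

Lemma int_comb_lin i : int_comb (alpha i).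
Proof.
exists (fun j => (j == i)%:Z), 0.
rewrite mulr0z addr0 (bigD1 i) //= eqxx mulr1z.
by rewrite big1 ?addr0 // => j /negPf->; rewrite mulr0z.
Qed.

Lemma int_comb_shift i : int_comb (alpha i + a).
Proof.
exists (fun j => (j == i)%:Z), 1; rewrite mulr1z (bigD1 i) //= eqxx mulr1z.
by rewrite big1 ?addr0 // => j /negPf->; rewrite mulr0z.
Qed.

(** The image of x is, up to sign, a nonnegative integral combination of the
    images of the alpha_i; the corresponding combination in V differs from x by
    a lattice vector in the kernel, a multiple of a. *)
Lemma root_int_comb (Q : vectType R) (pi : 'Hom(V, Q))
    (Phi : set V) x :
  zspan Phi `&` [set` lker pi] = zspan [set a] ->
  root_basis (pi @` Phi) (fun i => pi (alpha i)) ->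
  (forall i, Phi (alpha i)) -> Phi x -> int_comb x.
Proof.
move=> aE [_ _ basisP] Pa Px.
have [|d dP] := basisP (pi x); first by exists x.
have lift_pi (u : V) : zspan Phi u -> pi u = pi x ->
    exists l : int, x = u + a *~ l.
  move=> Lu pu; have : zspan [set a] (x - u).
    rewrite -aE; split; first by apply: zspanB => //; apply: mem_zspan.
    by rewrite /= memv_ker linearB /= pu subrr.
  by move=> /zspan1P[l xE]; exists l; rewrite -xE addrC subrK.
have Ld := zspan_comb d Pa.
have pd : pi (\sum_i alpha i *+ d i) = \sum_i pi (alpha i) *+ d i.
  by rewrite linear_sum; apply: eq_bigr => i _; rewrite linearMn.
case: dP => dE.
  have [l ->] := lift_pi _ Ld (etrans pd (esym dE)).
  by exists (fun i => (d i)%:Z), l.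
have [|l ->] := lift_pi _ (zspanN Ld); first by rewrite linearN /= pd dE.
exists (fun i => - (d i)%:Z), l; congr (_ + _); rewrite -sumrN.
by apply: eq_bigr => i _; rewrite mulrNz.
Qed.

End Lattice.

(** * The radical and the hyperbolic cover *)

Section Geometry.
Variables (R : realType) (V : vectType R) (f : {symmetric V}).
Variables (n : nat) (alpha : 'I_n.+1 -> V) (a : V) (m : 'I_n.+1 -> nat).
Let b := \sum_i alpha i *+ m i.

Lemma int_comb_refl x v :
  (forall i j, f (alpha i) (alpha j) \is a Num.int) -> (forall u, f a u = 0) ->
  int_comb alpha a x -> int_comb alpha a v -> f x x = 2 ->
  int_comb alpha a (refl f x v).
Proof.
move=> fint a0 Lx Lv nx; rewrite refl_norm2E //.
have /intrP[z ->] : f x v \is a Num.int.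
  case: Lx Lv => [c [l ->]] [c' [l' ->]].
  rewrite linearDl /= -[a *~ l]scaler_int linearZl_LR /= a0 mulr0 addr0.
  rewrite linearDr /= -[a *~ l']scaler_int linearZr_LR /= [f _ a]symm_formC a0.
  rewrite mulr0 addr0 symm_formC linear_sum rpred_sum // => i _ /=.
  rewrite -scaler_int linearZr_LR rpredM ?intr_int //=.
  rewrite symm_formC linear_sum rpred_sum // => j _ /=.
  by rewrite -scaler_int linearZr_LR rpredM ?intr_int ?fint.
by rewrite scaler_int; apply: int_combB => //; apply: int_combZ.
Qed.

Lemma span_coords v : v \in <<a :: [seq alpha i | i <- enum 'I_n.+1]>>%VS ->
  exists (d : 'I_n.+1 -> R) s, v = \sum_i d i *: alpha i + s *: a.
Proof.
rewrite span_cons => /memv_addP[_ /vlineP[s ->] [w]].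
move=> /(coord_span (X := [tuple alpha i | i < n.+1])) -> ->.
exists (fun i => coord [tuple alpha i | i < n.+1] i w), s; rewrite addrC.
by congr (_ + _); apply: eq_bigr => i _; rewrite -tnth_nth tnth_mktuple.
Qed.

Lemma free_coords (d : 'I_n.+1 -> R) s :
  free (a :: [seq alpha i | i <- enum 'I_n.+1]) ->
  \sum_i d i *: alpha i + s *: a = 0 -> (forall i, d i = 0) /\ s = 0.
Proof.
rewrite free_cons => /andP[aN fa] E.
have s0 : s = 0.
  apply/eqP; apply: contraR aN => s0.
  have -> : a = \sum_i (- (s^-1 * d i)) *: alpha i.
    apply: (scalerI s0); move/eqP: E; rewrite addrC addr_eq0 => /eqP->.
    rewrite scaler_sumr -sumrN; apply: eq_bigr => i _.
    by rewrite scalerA mulrN mulrA mulfV // mul1r scaleNr.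
  rewrite memv_suml // => i _.
  by rewrite memvZ // memv_span // map_f // mem_enum.
split=> // i; move: E; rewrite s0 scale0r addr0 => E.
apply: (elimT (freeP (X := [tuple alpha i | i < n.+1])) fa d).
by rewrite -[RHS]E; apply: eq_bigr => j _; rewrite -tnth_nth tnth_mktuple.
Qed.

(** Linear independence modulo the radical means that the functionals (e_i | -)
    are independent, so that they take arbitrary values simultaneously. *)
Lemma dual_of_free_mod_radical k (e : 'I_k -> V) :
  (forall d : 'I_k -> R, (forall v, f (\sum_i d i *: e i) v = 0) ->
    forall i, d i = 0) ->
  forall w : 'cV[R]_k, exists v, w = \col_i f (e i) v.
Proof.
move=> inj w; pose M := \matrix_(i < k, j < \dim {:V}) f (e i) (vbasis {:V})`_j.
have fM (d : 'rV_k) j : (d *m M) 0 j = f (\sum_i d 0 i *: e i) (vbasis {:V})`_j.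
  rewrite symm_formC linear_sum mxE; apply: eq_bigr => i _ /=.
  by rewrite mxE linearZr_LR /= symm_formC.
have Mfree : row_free M.
  apply: inj_row_free => d dM; apply/rowP=> i; rewrite mxE.
  apply: (inj (fun i => d 0 i)) => v.
  rewrite (coord_vbasis (memvf v)) linear_sum big1 // => j _ /=.
  by rewrite linearZr_LR /= -fM dM mxE mulr0.
exists (\sum_j (pinvmx M *m w) j 0 *: (vbasis {:V})`_j).
rewrite -[LHS]mul1mx -(mulmxVp Mfree) -mulmxA; apply/colP=> i.
rewrite !mxE linear_sum; apply: eq_bigr => j _ /=.
by rewrite mxE linearZr_LR /= mulrC.
Qed.

(** The span of alpha_1, ..., alpha_n is an orthogonal summand of a
    nondegenerate space, hence nondegenerate, and together with a and b it
    spans V. *)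
Lemma radical_of_cover (Vh : vectType R) (fh : {symmetric Vh})
    (iota : 'Hom(V, Vh)) (a' b' : Vh) :
  hyperbolic_cover f n <<[seq alpha (lift ord0 i) | i <- enum 'I_n]>>%VS
    a b fh iota a' b' ->
  m ord0 = 1%N -> (forall u, f a u = 0) -> (forall u, f b u = 0) ->
  (forall v, exists (d : 'I_n.+1 -> R) s,
    v = \sum_i d i *: alpha i + s *: a) ->
  forall v, (forall i, f (alpha i) v = 0) -> v \in <<[:: a; b]>>%VS.
Proof.
move=> cov m0 a0 b0 span_alpha v fv.
set Vf := <<_>>%VS in cov.
have [d [s vE]] := span_alpha v.
(* Since m_0 = 1, alpha_0 can be traded for b. *)
pose y := \sum_i (d (lift ord0 i) - d ord0 * (m (lift ord0 i))%:R)
  *: alpha (lift ord0 i).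
have {}vE : v = y + (s *: a + d ord0 *: b).
  rewrite vE /y /b !big_ord_recl m0 mulr1n scalerDr scaler_sumr.
  under [X in _ = X + _]eq_bigr do rewrite scalerBl -scalerA scaler_nat.
  rewrite sumrB [in RHS](addrC (s *: a)) [in RHS](addrC (d ord0 *: _)) !addrA.
  by rewrite subrK [in RHS](addrC _ (d ord0 *: _)).
have ab_in : s *: a + d ord0 *: b \in <<[:: a; b]>>%VS.
  by rewrite memvD // memvZ // memv_span // !inE eqxx ?orbT.
suff y0 : y = 0 by rewrite vE y0 add0r.
have yVf : y \in Vf.
  rewrite memv_suml // => i _.
  by rewrite memvZ // memv_span // map_f // mem_enum.
have fy z : z \in Vf -> f y z = 0.
  move=> zV; have : (Vf <= orthov f <[y]>)%VS.
    apply/span_subvP=> _ /mapP[i _ ->]; rewrite mem_orthov1.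
    have := fv (lift ord0 i); rewrite vE !linearDr !linearZr_LR /=.
    by rewrite [f _ a]symm_formC [f _ b]symm_formC a0 b0 !mulr0 !addr0 => ->.
  by move/subvP/(_ _ zV); rewrite mem_orthov1 symm_formC => /eqP.
have iy_rad : iota y \in orthov fh fullv.
  apply/mem_orthovP=> w _; have : w \in fullv by rewrite memvf.
  rewrite -(cover_sum cov) => /memv_addP[w12 w12P [w3 w3P ->]].
  case/memv_addP: w12P => _ /memv_imgP[z zV ->] [w2 w2P ->].
  have iyV : iota y \in (iota @: Vf)%VS by rewrite memv_img.
  have /subvP/(_ _ iyV)/mem_orthovP oa := cover_orth_a cov.
  have /subvP/(_ _ iyV)/mem_orthovP ob := cover_orth_b cov.
  by rewrite !linearDr /= (cover_isometry cov) fy // oa // ob // !addr0.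
move: iy_rad; have /eqP-> := cover_nondegenerate cov.
rewrite memv0 => /eqP iy0; apply: (lker0P _).
  by apply/eqP/(cover_inj cov).
by rewrite iy0 linear0.
Qed.

End Geometry.

(** * The tubular case *)

Lemma coxeter_prodE (R : realType) (V : vectType R) (f : {symmetric V}) n
    (x : option 'I_n.+1 -> V) a t (q : seq 'I_n.+1) :
  size q = n -> x None = x (Some t) + a ->
  lfun_prod [seq refl f (x i) | i <- map Some q ++ [:: Some t; None]] =
  coxeter f (fun i : 'I_n => x (Some (nth t q i))) (x (Some t)) a.
Proof.
move=> sz xN; rewrite map_cat lfun_prod_cat /coxeter /= -xN; congr (_ \o _)%VF.
  by rewrite /refl_prod -{1}(mkseq_nth t q) /mkseq sz -val_enum_ord -!map_comp.
by rewrite /lfun_prod !big_cons big_nil comp_lfun1r.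
Qed.

Lemma perm_split_option n t (p : seq (option 'I_n.+1)) :
  perm_eq p [seq i <- enum {: option 'I_n.+1} | i \notin [:: Some t; None]] ->
  exists2 q : seq 'I_n.+1, p = map Some q & perm_eq (t :: q) (enum 'I_n.+1).
Proof.
move=> pP.
have memp i : (i \in p) = (i \notin [:: Some t; None]).
  by rewrite (perm_mem pP) mem_filter mem_enum andbT.
have pE : p = map Some (pmap id p).
  have : None \notin p by rewrite memp !inE eqxx orbT.
  by elim: p {pP memp} => [|[i|] p IH] //=; rewrite inE /= => /IH <-.
exists (pmap id p) => //; apply: uniq_perm; rewrite ?enum_uniq //=.
  have up : uniq p by rewrite (perm_uniq pP) filter_uniq ?enum_uniq.
  move: up; rewrite {1}pE map_inj_uniq; last by move=> ? ? [].
  by move=> ->; rewrite andbT -(mem_map (@Some_inj _)) -pE memp !inE eqxx.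
move=> i; rewrite mem_enum inE -(mem_map (@Some_inj _)) -pE memp !inE orbF.
by rewrite (inj_eq (@Some_inj _)) orbN.
Qed.

Lemma sum_split_nth (M : nmodType) n t (q : seq 'I_n.+1) (F : 'I_n.+1 -> M) :
  perm_eq (t :: q) (enum 'I_n.+1) ->
  \sum_j F j = F t + \sum_(i < n) F (nth t q i).
Proof.
move=> qP; have sz : size q = n.
  by have /perm_size := qP; rewrite size_enum_ord => -[].
rewrite -big_enum /= -(perm_big _ qP) big_cons; congr (_ + _).
by rewrite (big_nth t) sz big_mkord.
Qed.

(** Evaluate both reflections at x. *)
Lemma refl_eq_collinear (R : realType) (V : vectType R) (f : {symmetric V})
    x y :
  f x x = 2 -> f y y = 2 -> refl f x = refl f y -> exists k, x = k *: y.
Proof.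
move=> nx ny /(congr1 (fun g : 'End(V) => g x)); rewrite !refl_norm2E // nx.
move/addrI/oppr_inj => E; exists (2^-1 * f y x).
by rewrite -scalerA -E scalerA mulVf ?scale1r // pnatr_eq0.
Qed.

Section Tubular.
Variables (R : realType) (V : vectType R) (f : {symmetric V}) (n : nat).
Variables (alpha : 'I_n.+1 -> V) (a : V) (m : 'I_n.+1 -> nat) (t : 'I_n.+1).
Variable q : seq 'I_n.+1.
Let b := \sum_i alpha i *+ m i.
Let e (i : 'I_n) := alpha (nth t q i).
Hypothesis norm_alpha : forall i, f (alpha i) (alpha i) = 2.
Hypothesis rad_a : forall v, f a v = 0.
Hypothesis rad_b : forall v, f b v = 0.
Hypothesis free_alpha : forall (d : 'I_n.+1 -> R) s,
  \sum_i d i *: alpha i + s *: a = 0 -> (forall i, d i = 0) /\ s = 0.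
Hypothesis rad_ab :
  forall v, (forall i, f (alpha i) v = 0) -> v \in <<[:: a; b]>>%VS.
Hypothesis m_gt0 : forall i, (0 < m i)%N.
Hypothesis m_lt : forall i, i != t -> (m i < m t)%N.
Hypothesis qP : perm_eq (t :: q) (enum 'I_n.+1).

Lemma size_other_nodes : size q = n.
Proof. by have /perm_size := qP; rewrite size_enum_ord => -[]. Qed.

Lemma uniq_nodes : uniq (t :: q).
Proof. by rewrite (perm_uniq qP) enum_uniq. Qed.

Lemma other_node_neq (i : 'I_n) : nth t q i != t.
Proof.
have := uniq_nodes; rewrite /= => /andP[tq _].
by apply: contra tq => /eqP <-; rewrite mem_nth ?size_other_nodes.
Qed.

Lemma alpha_collinear i j k s :
  alpha i = k *: alpha j + s *: a -> i = j /\ s = 0.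
Proof.
move=> E; have [] := free_alpha
    (d := fun l => (l == i)%:R - k * (l == j)%:R) (s := - s).
  under eq_bigr do rewrite scalerBl -scalerA.
  rewrite sumrB (bigD1 i) //= eqxx scale1r big1 => [|l /negPf->]; last first.
    by rewrite scale0r.
  rewrite (bigD1 j) //= eqxx scale1r big1 => [|l /negPf->]; last first.
    by rewrite scale0r scaler0.
  by rewrite !addr0 {1}E [_ + s *: a]addrC addrK scaleNr subrr.
move=> /(_ i); rewrite eqxx => + /eqP; rewrite oppr_eq0 => + /eqP->.
by case: eqP => // _ /eqP; rewrite mulr0 subr0 oner_eq0.
Qed.

Lemma tubular_refl_inj :
  injective (fun i => refl f (tubular_root alpha a t i)).
Proof.
have nx i : f (tubular_root alpha a t i) (tubular_root alpha a t i) = 2.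
  case: i => [i|] /=; first exact: norm_alpha.
  exact: norm_shift.
move=> i j /(refl_eq_collinear (nx i) (nx j))[k].
case: i j => [i|] [j|] //= E.
- by have [|->] := @alpha_collinear i j k 0; rewrite ?scale0r ?addr0.
- have [|_ k0] := @alpha_collinear i t k k; first by rewrite E scalerDr.
  have := norm_alpha i; rewrite E k0 scale0r linear0l => /eqP.
  by rewrite eq_sym pnatr_eq0.
- have [|_ /eqP] := @alpha_collinear t j k (-1); last first.
    by rewrite oppr_eq0 oner_eq0.
  by rewrite -E scaleN1r addrK.
Qed.

(** The freeness of the whole family, with the root alpha_t singled out; the
    inverse of the enumeration [q] is the index function. *)
Lemma free_split (d : 'I_n -> R) r s :
  \sum_i d i *: e i + r *: alpha t + s *: a = 0 ->
  [/\ forall i, d i = 0, r = 0 & s = 0].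
Proof.
move=> E; pose D j := if j == t then r else
  if insub (index j q) is Some i then d i else 0.
have Dt : D t = r by rewrite /D eqxx.
have De (i : 'I_n) : D (nth t q i) = d i.
  rewrite /D (negPf (other_node_neq i)).
  rewrite index_uniq ?size_other_nodes //; last first.
    by have := uniq_nodes; rewrite /= => /andP[].
  by rewrite valK.
have [|D0 s0] := @free_alpha D s.
  rewrite (sum_split_nth _ qP) Dt -[RHS]E [r *: _ + _]addrC; congr (_ + _ + _).
  by apply: eq_bigr => i _; rewrite De.
by split=> [i||] //; rewrite -?De -?Dt D0.
Qed.

Lemma radical_relation v :
  (m t)%:R * f (alpha t) v + \sum_(i < n) (m (nth t q i))%:R * f (e i) v = 0.
Proof.
rewrite -[RHS](rad_b v) [f b v]symm_formC /b linear_sum (sum_split_nth _ qP) /=.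
rewrite linearMn /= mulr_natl symm_formC; congr (_ + _).
by apply: eq_bigr => i _; rewrite linearMn /= symm_formC mulr_natl.
Qed.

Lemma perp_split v : f (alpha t) v = 0 -> (forall i, f (e i) v = 0) ->
  v \in <<[:: a; b]>>%VS.
Proof.
move=> tv ev; apply: rad_ab => i.
have : i \in t :: q by rewrite (perm_mem qP) mem_enum.
rewrite inE => /orP[/eqP->//|iq].
have iq' : (index i q < n)%N by move: iq; rewrite -index_mem size_other_nodes.
by have := ev (Ordinal iq'); rewrite /e /= nth_index.
Qed.

Lemma tubular_coxeter_fixed v :
  coxeter f e (alpha t) a v = v -> v \in <<[:: a; b]>>%VS.
Proof.
case/coxeter_fixed => // [i|d s E|ev tv].
- exact: norm_alpha.
- by have [|] := @free_split d 0 s; first by rewrite scale0r addr0.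
- exact: perp_split.
Qed.

(** A vanishing combination modulo the radical is s a + r b.  Its coordinate at
    alpha_t is r m_t, so r = 0 because m_t is not 0. *)
Lemma other_roots_dual (w : 'cV[R]_n) : exists v, w = \col_i f (e i) v.
Proof.
apply: dual_of_free_mod_radical => d dE.
have : \sum_i d i *: e i \in <<[:: a; b]>>%VS.
  by apply: rad_ab => i; rewrite symm_formC dE.
rewrite span_cons span_seq1 => /memv_addP[_ /vlineP[s ->] [_ /vlineP[r ->]]] E.
have [|d0 /eqP r0 _] := @free_split
    (fun i : 'I_n => d i - r * (m (nth t q i))%:R) (- (r * (m t)%:R)) (- s).
  under eq_bigr do rewrite scalerBl -scalerA scaler_nat.
  rewrite sumrB E !scaleNr -scalerA scaler_nat {1}/b (sum_split_nth _ qP).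
  by rewrite scalerDr scaler_sumr !addrA !addrK subrr.
move: r0; rewrite oppr_eq0 mulf_eq0 pnatr_eq0 -[m t == 0%N]negbK -lt0n.
rewrite m_gt0 orbF.
by move=> /eqP r0 i; have := d0 i; rewrite r0 mul0r subr0.
Qed.

Lemma coxeter_not_product_of_n (x : 'I_n -> V) : (0 < n)%N ->
  (forall i, int_comb alpha a (x i)) -> (forall i, f (x i) (x i) = 2) ->
  refl_prod f x <> coxeter f e (alpha t) a.
Proof.
move=> n_gt0 /fin_all_exists[c] /fin_all_exists[l] xE nx.
apply: (@no_short_factorization _ _ f n e x (alpha t) a
  (fun i : 'I_n => m (nth t q i)) (m t) (Ordinal n_gt0)
  (\matrix_(i < n, j < n) c j (nth t q i)) (\row_j c j t) (\row_j l j)) => //.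
- by move=> i; apply: norm_alpha.
- exact: free_split.
- exact: other_roots_dual.
- exact: radical_relation.
- by rewrite m_gt0 m_lt ?other_node_neq.
move=> j; rewrite xE (sum_split_nth _ qP) !mxE [_ + \sum__ _]addrC.
by congr (_ + _ + _); apply: eq_bigr => i _; rewrite mxE.
Qed.

(** The fixed plane gives at least n factors, parity excludes n + 1, and
    integrality of the roots excludes n. *)
Lemma tubular_length_bound (s : seq 'End(V)) :
  (0 < n)%N -> \dim {:V} = n.+2 ->
  {in s, forall g, exists x,
    [/\ int_comb alpha a x, f x x = 2 & g = refl f x]} ->
  lfun_prod s = coxeter f e (alpha t) a -> odd (size s) = odd n ->
  (n.+2 <= size s)%N.
Proof.
move=> n_gt0 dimV sP sE odd_s.
have n_le : (n <= size s)%N.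
  rewrite -(leq_add2r 2) addn2 -dimV.
  apply: (@factor_bound _ _ f _ a b) => [g /sP[x [_ nx ->]]|].
    by exists x.
  by rewrite sE; apply/subvP=> v /fixedSpaceP/tubular_coxeter_fixed.
have n_neq : size s != n.
  apply/eqP=> sz; have := refl_factors sP; rewrite sz => -[x [Lx nx xE]].
  by apply: (coxeter_not_product_of_n n_gt0 Lx nx); rewrite -xE.
have n1_neq : size s != n.+1.
  by apply/eqP=> sz; move: odd_s; rewrite sz /=; case: (odd n).
by rewrite ltn_neqAle eq_sym n1_neq ltn_neqAle eq_sym n_neq.
Qed.

(** The space V + R b' is seen through an isometric embedding [j] of V and the
    complementary vector [c]. *)
Section Cover.
Variables (E : vectType R) (fE : {symmetric E}) (j : {linear V -> E}) (c : E).
Hypothesis iso_j : forall u v, fE (j u) (j v) = f u v.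
Hypothesis inj_j : injective j.
Hypothesis span_jc : forall v, exists u z, v = j u + z *: c.
Hypothesis fac : fE (j a) c = 0.
Hypothesis fbc : fE (j b) c = 1.

Lemma cover_rad_a v : fE (j a) v = 0.
Proof.
have [u [z ->]] := span_jc v.
by rewrite linearDr linearZr_LR /= fac mulr0 addr0 iso_j.
Qed.

(** Orthogonality to all simple roots includes orthogonality to b, which kills
    the component along [c] because (b | c) = 1. *)
Lemma cover_coxeter_fixed v :
  coxeter fE (fun i => j (e i)) (j (alpha t)) (j a) v = v ->
  v \in <<[:: j a; j b]>>%VS.
Proof.
case/coxeter_fixed => [i||u|d s|ev tv].
- by rewrite iso_j norm_alpha.
- by rewrite iso_j norm_alpha.
- exact: cover_rad_a.
- move=> dE; have [|//] := @free_split d 0 s.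
  apply: inj_j.
  rewrite scale0r addr0 linearD linearZ linear_sum linear0 -[RHS]dE.
  by congr (_ + _); apply: eq_bigr => i _; rewrite linearZ.
have [u [z vE]] := span_jc v.
have : fE (j b) v = 0.
  rewrite symm_formC /b (sum_split_nth _ qP) linearD linear_sum linearDr.
  rewrite linear_sum /=.
  rewrite linearMn linearMn /= symm_formC tv mul0rn add0r big1 // => i _.
  by rewrite linearMn linearMn /= symm_formC ev mul0rn.
rewrite {1}vE linearDr linearZr_LR /= fbc mulr1 iso_j rad_b add0r => z0.
move: vE; rewrite z0 scale0r addr0 => vE.
have fu w : f w u = fE (j w) v by rewrite vE iso_j.
have : u \in <<[:: a; b]>>%VS by apply: perp_split => [|i]; rewrite fu.
rewrite vE span_cons span_seq1.
case/memv_addP=> _ /vlineP[s ->] [_ /vlineP[r ->] ->].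
by rewrite linearD !linearZ /= memvD // memvZ // memv_span // !inE eqxx ?orbT.
Qed.

(** The fixed plane now has codimension n + 1, so parity suffices. *)
Lemma cover_length_bound (s : seq 'End(E)) :
  \dim {:E} = n.+3 ->
  {in s, forall g, exists2 x, fE x x = 2 & g = refl fE x} ->
  lfun_prod s = coxeter fE (fun i => j (e i)) (j (alpha t)) (j a) ->
  odd (size s) = odd n -> (n.+2 <= size s)%N.
Proof.
move=> dimE sP sE odd_s.
have n_le : (n.+1 <= size s)%N.
  rewrite -(leq_add2r 2) addn2 -dimE.
  apply: (@factor_bound _ _ fE _ (j a) (j b)) => //.
  by rewrite sE; apply/subvP=> v /fixedSpaceP/cover_coxeter_fixed.
have n1_neq : size s != n.+1.
  by apply/eqP=> sz; move: odd_s; rewrite sz /=; case: (odd n).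
by rewrite ltn_neqAle eq_sym n1_neq.
Qed.

End Cover.

End Tubular.

Theorem proposition1p2
  (R : realType) (V : vectType R) (f : {symmetric V}) (n : nat) (Phi : set V)
  (Phi_elliptic : elliptic f n Phi)
  (Phi_norm : forall alpha, Phi alpha -> f alpha alpha = 2)
  (U : {vspace V}) (U_dim : \dim U = 1%N) (U_rad : (U <= orthov f fullv)%VS)
  (U_lattice : [set` U] `&` zspan Phi <> [set 0])
  (a : V) (a_gen : zspan Phi `&` [set` U] = zspan [set a])
  (Q : vectType R) (pi : 'Hom(V, Q)) (g : {symmetric Q})
  (Q_quotient : quotient_space f U pi g)
  (beta : 'I_n.+1 -> Q) (beta_basis : root_basis (pi @` Phi) beta)
  (beta_finite : exists W : {vspace Q}, exists2 Psi : set Q,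
    finite_root_system g W Psi &
    root_basis Psi (fun i : 'I_n => beta (lift ord0 i)))
  (m : 'I_n.+1 -> nat) (m0 : m ord0 = 1%N) (m_gt0 : forall i, (0 < m i)%N)
  (m_gen : zspan (pi @` Phi) `&` [set` (pi @: orthov f fullv)%VS] =
    zspan [set \sum_i beta i *+ m i])
  (alpha : 'I_n.+1 -> V) (alpha_root : forall i, Phi (alpha i))
  (alpha_preimage : forall i, pi (alpha i) = beta i)
  (t : 'I_n.+1) (tubular : forall i, m i = \max_j m j <-> i = t)
  (Vh : vectType R) (fh : {symmetric Vh}) (iota : 'Hom(V, Vh)) (a' b' : Vh)
  (cover : hyperbolic_cover f n
    <<[seq alpha (lift ord0 i) | i <- enum 'I_n]>>%VS
    a (\sum_i alpha i *+ m i) fh iota a' b')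
  (p : seq (option 'I_n.+1))
  (p_order : perm_eq p
    [seq i <- enum {: option 'I_n.+1} | i \notin [:: Some t; None]]) :
  let s i := refl f (tubular_root alpha a t i) in
  let S := range s in
  let W := gen_group [set refl f x | x in Phi] in
  let T := reflections W S in
  let c := lfun_prod [seq s i | i <- p ++ [:: Some t; None]] in
  let Vt := cover_space iota b' in
  let st i := refl (restr_form fh (A := Vt))
                (vsproj Vt (iota (tubular_root alpha a t i))) in
  let St := range st in
  let Wt := gen_group St in
  let Tt := reflections Wt St in
  let ct := lfun_prod [seq st i | i <- p ++ [:: Some t; None]] in
  exists k : nat,
    [/\ has_length Tt ct k, has_length T c k & S #= `I_k].
Proof.
move=> s S W T c Vt st St Wt Tt ct.
have [rs _ _ _ dimV] := Phi_elliptic.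
have kerE := quotient_ker Q_quotient.
pose b := \sum_i alpha i *+ m i.
have [_ Ua] : (zspan Phi `&` [set` U]) a by rewrite a_gen; apply: mem_zspan.
have rad_a v : f a v = 0.
  by have /subvP/(_ a Ua)/mem_orthovP := U_rad; apply; rewrite memvf.
have betaE : beta = fun i => pi (alpha i) by apply/funext.
have rad_b v : f b v = 0.
  have : (zspan (pi @` Phi) `&` [set` (pi @: orthov f fullv)%VS])
      (\sum_i beta i *+ m i) by rewrite m_gen; apply: mem_zspan.
  case=> _ /= /memv_imgP[u uR piu].
  have : b - u \in U.
    rewrite -kerE memv_ker linearB /= -piu subr_eq0 linear_sum; apply/eqP.
    by apply: eq_bigr => i _; rewrite linearMn /= alpha_preimage.
  move=> /(subvP U_rad)/mem_orthovP/(_ v (memvf v)).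
  have /mem_orthovP/(_ v (memvf v)) fu := uR.
  by rewrite linearBl /= fu subr0.
have norm_alpha i : f (alpha i) (alpha i) = 2 by apply: Phi_norm.
have root_comb x : Phi x -> int_comb alpha a x.
  apply: (@root_int_comb _ _ _ alpha a Q pi) => //; first by rewrite kerE.
  by rewrite -betaE.
have span_alpha v : v \in <<a :: [seq alpha i | i <- enum 'I_n.+1]>>%VS.
  have : [set` {:V}%VS] v by rewrite /= memvf.
  rewrite -(root_span rs) => -[r rP]; apply/subvP/span_subvP => x /rP/root_comb.
  case=> k [l ->]; rewrite memvD //.
    apply: memv_suml => i _; rewrite -scaler_int memvZ // memv_span //.
    by rewrite inE map_f ?orbT // mem_enum.
  by rewrite -scaler_int memvZ // memv_span // mem_head.
(* A spanning family of n + 2 vectors in dimension n + 2. *)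
have free_aalpha : free (a :: [seq alpha i | i <- enum 'I_n.+1]).
  apply: (@basis_free _ _ fullv); rewrite basisEdim dimV /= size_map.
  by rewrite size_enum_ord ltnSn andbT; apply/subvP=> v _.
have free_alpha d r := @free_coords _ _ n alpha a d r free_aalpha.
have rad_ab : forall v, (forall i, f (alpha i) v = 0) -> v \in <<[:: a; b]>>%VS.
  apply: (radical_of_cover cover) => // v; exact: span_coords.
have fint i j : f (alpha i) (alpha j) \is a Num.int.
  have := root_int rs (alpha_root i) (alpha_root j).
  by rewrite norm_alpha mulrAC mulfV ?mul1r // pnatr_eq0.
(* For n = 0 the root alpha_0 would be equal to b and lie in the radical. *)
have n_gt0 : (0 < n)%N.
  rewrite lt0n; apply/eqP=> n0; have := norm_alpha ord0.
  have -> : alpha ord0 = b.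
    rewrite /b big_ord_recl m0 big1 ?addr0 // => i _.
    by have := leq_trans (ltn_ord i) (eq_leq n0); rewrite ltn0.
  by rewrite rad_b => /eqP; rewrite eq_sym pnatr_eq0.
have mtE : m t = \max_j m j by apply/tubular.
have m_lt i : i != t -> (m i < m t)%N.
  move=> it; rewrite ltn_neqAle mtE leq_bigmax andbT.
  by apply: contra it => /eqP/tubular->.
have [q pE qP] := perm_split_option p_order.
have sz_q := size_other_nodes qP.
pose e (i : 'I_n) := alpha (nth t q i).
have cE : c = coxeter f e (alpha t) a.
  rewrite /c pE; exact: (@coxeter_prodE _ _ f n (tubular_root alpha a t)).
have size_c : size (p ++ [:: Some t; None]) = n.+2.
  by rewrite pE size_cat size_map sz_q addn2.
have L_root i : int_comb alpha a (tubular_root alpha a t i).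
  by case: i => [i|]; [exact: int_comb_lin | exact: int_comb_shift].
have norm_root i : f (tubular_root alpha a t i) (tubular_root alpha a t i) = 2.
  by case: i => [i|]; rewrite /= ?norm_alpha // norm_shift.
pose J : {linear V -> subvs_of Vt} := vsproj Vt \o iota.
have valJ u : vsval (J u) = iota u.
  rewrite vsprojK // /Vt /cover_space.
  by rewrite (subvP (addvSl _ _)) // memv_img // memvf.
set fE := restr_form fh (A := Vt) in st St Wt Tt ct *.
have iso_J u v : fE (J u) (J v) = f u v.
  by rewrite /fE /restr_form !valJ (cover_isometry cover).
have iota_inj : injective iota by apply/lker0P/eqP/(cover_inj cover).
have inj_J : injective J.
  by move=> u v /(congr1 vsval); rewrite !valJ => /iota_inj.
have b'Vt : b' \in Vt by rewrite (subvP (addvSr _ _)) // memv_line.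
pose b'' := vsproj Vt b'.
have valb : vsval b'' = b' by rewrite vsprojK.
have span_Jb v : exists u z, v = J u + z *: b''.
  have := subvsP v; rewrite /Vt /cover_space.
  case/memv_addP=> _ /memv_imgP[u _ ->] [_ /vlineP[z ->]] vE.
  exists u, z; apply: subvs_inj; rewrite vE linearD linearZ /=.
  by rewrite [X in _ = X + _]valJ [X in _ = _ + _ *: X]valb.
have fab : fE (J a) b'' = 0.
  rewrite /fE /restr_form valJ valb.
  have /orthovP := cover_orth_ab cover; apply;
    by rewrite memv_span // !inE ?eqxx ?orbT.
have fbb : fE (J b) b'' = 1.
  by rewrite /fE /restr_form valJ valb; have [] := cover_pair_b cover.
have dimE : \dim {:subvs_of Vt} = n.+3.
  rewrite dimvf -[dim _]/(\dim Vt) /Vt /cover_space dimv_disjoint_sum.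
    rewrite limg_dim_eq ?(cover_inj cover) ?capv0 // dimV dim_vline.
    suff -> : b' != 0 by rewrite addn1.
    have [_ _ bb1] := cover_pair_b cover; apply/eqP=> b0; move/eqP: bb1.
    by rewrite b0 linear0 eq_sym oner_eq0.
  apply/eqP; rewrite -subv0; apply/subvP=> w.
  rewrite memv_cap memv0 => /andP[/memv_imgP[u _ ->] /vlineP[z uz]].
  have := rad_b u; rewrite -(cover_isometry cover) uz linearZr_LR /=.
  by have [_ _ ->] := cover_pair_b cover; rewrite mulr1 => ->; rewrite scale0r.
have ctE : ct = coxeter fE (fun i => J (e i)) (J (alpha t)) (J a).
  rewrite /ct pE.
  apply: (@coxeter_prodE _ _ fE n
    (fun i => J (tubular_root alpha a t i))) => //.
  exact: (linearD J).
have norm_rootJ i :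
    fE (J (tubular_root alpha a t i)) (J (tubular_root alpha a t i)) = 2.
  by rewrite iso_J.
have TP h : T h -> exists x, [/\ int_comb alpha a x, f x x = 2 & h = refl f x].
  apply: reflections_refl => [x v||_ [i _ <-]].
  - by move=> Lx nx Lv; apply: int_comb_refl.
  - by move=> _ [x Px <-]; exists x; split; [exact: root_comb|exact: Phi_norm|].
  - by exists (tubular_root alpha a t i).
have TtP h : Tt h -> exists2 x, fE x x = 2 & h = refl fE x.
  have StP h' : St h' -> exists x, [/\ True, fE x x = 2 & h' = refl fE x].
    by case=> i _ <-; exists (J (tubular_root alpha a t i)).
  by case/(@reflections_refl _ _ fE (fun=> True))=> // x [_ nx ->]; exists x.
exists n.+2; split.
- have facP : factorization Tt ct [seq st i | i <- p ++ [:: Some t; None]].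
    split=> // _ /mapP[i _ ->]; apply: sub_reflections; first exact: gen_one.
    by exists i.
  split.
    by exists [seq st i | i <- p ++ [:: Some t; None]]; rewrite ?size_map.
  move=> r [rT rE].
  apply: (cover_length_bound norm_alpha rad_a rad_b free_alpha rad_ab qP iso_J
    inj_J span_Jb fab fbb) => //.
  + by move=> h /rT/TtP.
  + by rewrite -rE.
  + have := @factor_parity _ _ fE r [seq st i | i <- p ++ [:: Some t; None]].
    rewrite size_map size_c /= negbK.
    apply=> [h /rT/TtP//|h /(proj1 facP)/TtP//|].
    by rewrite -rE.
- have facP : factorization T c [seq s i | i <- p ++ [:: Some t; None]].
    split=> // _ /mapP[i _ ->]; apply: sub_reflections; first exact: gen_one.
    by exists i.
  split.
    by exists [seq s i | i <- p ++ [:: Some t; None]]; rewrite ?size_map.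
  move=> r [rT rE].
  apply: (tubular_length_bound norm_alpha rad_a rad_b free_alpha rad_ab m_gt0
    m_lt qP) => //.
  + by move=> h /rT/TP.
  + by rewrite -rE.
  + have := @factor_parity _ _ f r [seq s i | i <- p ++ [:: Some t; None]].
    rewrite size_map size_c /= negbK.
    apply=> [h /rT/TP[x [_ ? ?]]|h /(proj1 facP)/TP[x [_ ? ?]]|];
      [by exists x|by exists x|].
    by rewrite -rE.
- have s_inj : injective s by apply: (tubular_refl_inj norm_alpha).
  apply: card_eq_trans (inj_card_eq (in2W s_inj)) _.
  have <- : #|{: option 'I_n.+1}| = n.+2 by rewrite card_option card_ord.
  apply: card_eq_trans (card_esym card_II).
  have <- : range (@enum_rank (option 'I_n.+1)) = setT.
    by apply/seteqP; split=> // i _; exists (enum_val i); rewrite ?enum_valK.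
  by apply: card_esym; apply: inj_card_eq; apply: in2W; apply: enum_rank_inj.
Qed.
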